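(* Define - $\mathcal{X}_{\text{RO}}=\{\boldsymbol{x}\in\mathcal{X}\mid f_m(\boldsymbol{a}_m,\boldsymbol{x})\le b_m,\ \forall\boldsymbol{a}_m\in\mathcal{A}_m,\ \forall m\in[M]\}$, - $\mathcal{X}_{\text{AS-DRO}}=\{\boldsymbol{x}\in\mathcal{X}\mid\inf_{\mathbb{P}_m\in\mathcal{P}_m}\mathbb{P}_m[f_m(\boldsymbol{a}_m,\boldsymbol{x})\le b_m]=1,\ \forall m\in[M]\}$ (equivalently, $\mathbb P_m[f_m(\boldsymbol a_m,\boldsymbol x)\le b_m]=1$ for every $\mathbb P_m\in\mathcal P_m$ and every $m\in[M]$), - $\mathcal{X}_{\text{DRO}}=\{\boldsymbol{x}\in\mathcal{X}\mid\sup_{\mathbb{P}_m\in\mathcal{P}_m}\mathbb{E}_{\mathbb{P}_m}[f_m(\boldsymbol{a}_m,\boldsymbol{x})]\le b_m,\ \forall m\in[M]\}$. Then $$\mathcal{X}_{\text{RO}}\subseteq\mathcal{X}_{\text{AS-DRO}}\subseteq\mathcal{X}_{\text{DRO}}.$$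
   Context: $[M]=\{1,\dots,M\}$, $\mathcal X\subseteq\mathbb R^n$, $\boldsymbol b\in\mathbb R^M$. For each $m\in[M]$: $\mathcal A_m\subseteq\mathbb R^n$ carries its Borel $\sigma$-algebra $\mathcal F_m$; $f_m:\mathcal A_m\times\mathcal X\to\mathbb R$; and, for finitely many measurable $g_t:\mathcal A_m\to\mathbb R$, $t\in[T_m]$ (possibly depending on $m$), and $\gamma_{mt}\in\mathbb R$, $$\mathcal P_m=\{\mathbb P \text{ nonnegative measure on }(\mathcal A_m,\mathcal F_m):\ \mathbb P(\mathcal A_m)=1,\ \mathbb E_{\mathbb P}[g_t^-]<\infty,\ \mathbb E_{\mathbb P}[g_t]\le\gamma_{mt}\ \forall t\in[T_m]\},\quad g_t^-=\max\{-g_t,0\}.$$ Standing assumption: for each $m$, $\mathcal P_m\neq\varnothing$ and: (i) $\mathcal A_m$ is nonempty and closed, $f_m(\cdot,\boldsymbol x)$ is upper semicontinuous on $\mathcal A_m$ for every $\boldsymbol x\in\mathcal X$, and each $g_t$ is lower semicontinuous; (ii) for every $\boldsymbol x\in\mathcal X$ there are scalars $\beta_{0m}(\boldsymbol x)\in\mathbb R$, $\beta_{tm}(\boldsymbol x)\ge0$ with $|f_m(\boldsymbol a,\boldsymbol x)|\le\beta_{0m}(\boldsymbol x)+\sum_{t\in[T_m]}\beta_{tm}(\boldsymbol x)|g_t(\boldsymbol a)|$ for all $\boldsymbol a\in\mathcal A_m$ (so $f_m(\cdot,\boldsymbol x)$ is integrable under every $\mathbb P\in\mathcal P_m$). *)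

(* Defs.v *)
From HB Require Import structures.
From mathcomp Require Export all_boot all_order all_algebra.
From mathcomp Require Export all_classical all_reals all_analysis.

Set Implicit Arguments.
Unset Strict Implicit.
Unset Printing Implicit Defensive.

Import Order.TTheory GRing.Theory Num.Theory.
Import numFieldNormedType.Exports.

Local Open Scope classical_set_scope.
Local Open Scope ring_scope.

(* [nonempty_sub A0] is [set_type A] with its subspace topology. The proof [A0]
   only provides the default point that the library requires of every
   measurable space; it plays no other role. *)
Definition nonempty_sub (V : topologicalType) (A : set V) (A0 : A !=set0) : Type :=
  set_type A.

Section nonempty_sub.
Context (V : topologicalType) (A : set V) (A0 : A !=set0).

HB.instance Definition _ := Topological.copy (nonempty_sub A0) (set_type A).
HB.instance Definition _ := isPointed.Build (nonempty_sub A0)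
  (SigSub (mem_set (svalP (cid A0))) : set_type A).

End nonempty_sub.

Notation borel_sub A0 := (g_sigma_algebraType (@open (nonempty_sub A0))).

(* Dual of the library's [lower_semicontinuous]. *)
Definition upper_semicontinuous (V : topologicalType) (R : realType)
    (h : V -> \bar R) : Prop :=
  forall v (c : R), (h v < c%:E)%E ->
    exists2 U, nbhs v U & forall w, U w -> (h w < c%:E)%E.

(* [P setT = 1] is part of the type [probability]. The library integral of a
   function is the integral of its positive part minus that of its negative
   part, so ['E_P[g t]] is meaningful, possibly [+oo], as soon as
   ['E_P[(g t)^\-]] is finite. *)
Definition ambiguity_set (d : measure_display) (Omega : measurableType d)
    (R : realType) (T : nat) (g : 'I_T -> Omega -> R) (gamma : 'I_T -> R) :
    set (probability Omega R) :=
  [set P | forall t, ('E_P[(g t)^\-] < +oo)%E /\ ('E_P[g t] <= (gamma t)%:E)%E].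

Definition X_RO (R : realType) (n M : nat) (X : set 'rV[R]_n) (b : 'rV[R]_M)
    (A : 'I_M -> set 'rV[R]_n) (f : forall m, A m -> X -> R) : set X :=
  [set x | forall m (a : A m), f m a x <= b ord0 m].

Definition X_AS_DRO (R : realType) (n M : nat) (X : set 'rV[R]_n)
    (b : 'rV[R]_M) (A : 'I_M -> set 'rV[R]_n) (A0 : forall m, A m !=set0)
    (f : forall m, A m -> X -> R)
    (P : forall m, set (probability (borel_sub (A0 m)) R)) : set X :=
  [set x | forall m,
    ereal_inf [set Q [set a | f m a x <= b ord0 m] | Q in P m] = 1%E].

Definition X_DRO (R : realType) (n M : nat) (X : set 'rV[R]_n)
    (b : 'rV[R]_M) (A : 'I_M -> set 'rV[R]_n) (A0 : forall m, A m !=set0)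
    (f : forall m, A m -> X -> R)
    (P : forall m, set (probability (borel_sub (A0 m)) R)) : set X :=
  [set x | forall m,
    (ereal_sup [set 'E_Q[fun a => f m a x] | Q in P m] <= (b ord0 m)%:E)%E].

(* Main.v *)
Require Import Defs.
From mathcomp Require Import measurable_realfun.

Set Implicit Arguments.
Unset Strict Implicit.
Unset Printing Implicit Defensive.

Import Order.TTheory GRing.Theory Num.Theory.
Import numFieldNormedType.Exports.

Local Open Scope classical_set_scope.
Local Open Scope ring_scope.

(** Upper semicontinuity makes [f m a x] Borel in [a], so the event [f m a x <= b ord0 m] has a
    probability. If the constraint holds pointwise, this event is the whole space and has mass 1
    under every member of the nonempty set [P m]. If the infimum of its probabilities is 1, each [Q]
    in [P m] gives it mass 1; the bound then holds almost surely, and [expectation_ae_le] integrates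
    it. *)

Lemma upper_semicontinuous_open (V : topologicalType) (R : realType)
    (h : V -> \bar R) (c : R) :
  upper_semicontinuous h -> open [set v | (h v < c%:E)%E].
Proof.
move=> h_usc; rewrite openE => v /= /h_usc[U vU Uc].
exact: filterS vU.
Qed.

(** The open left rays generate the Borel sets of the line, and their preimages are open. *)
Lemma upper_semicontinuous_measurable (V : ptopologicalType) (R : realType)
    (h : V -> R) :
  upper_semicontinuous (EFin \o h) ->
  measurable_fun [set: g_sigma_algebraType (@open V)]
    (h : g_sigma_algebraType (@open V) -> R).
Proof.
move=> h_usc; apply: (measurability _ (RGenInftyO.measurableE R)).
move=> /= _ [_ [c ->]] <-; rewrite setTI; apply: sub_sigma_algebra.
suff -> : h @^-1` `]-oo, c[ = [set v | ((EFin \o h) v < c%:E)%E].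
  exact: upper_semicontinuous_open.
by apply/seteqP; split=> v /=; rewrite in_itv /= lte_fin.
Qed.

Section almost_sure_bound.
Context (d : measure_display) (Omega : measurableType d) (R : realType).
Variable Q : probability Omega R.

Lemma probability1_ae (S : set Omega) :
  measurable S -> Q S = 1%E -> {ae Q, forall w, S w}.
Proof.
move=> mS QS; exists (~` S); split=> //; first exact: measurableC.
by rewrite probability_setC// QS subee.
Qed.

(* No integrability is needed: if the negative part of [h] has infinite
   integral, then the expectation is [-oo], as the positive part is bounded. *)
Lemma expectation_ae_le (h : Omega -> R) (c : R) :
  measurable_fun [set: Omega] h -> {ae Q, forall w, h w <= c} ->
  ('E_Q[h] <= c%:E)%E.
Proof.
(* As [Q] has mass 1, [c] is the integral of a constant, so two integrals are to be compared. *)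
move=> /measurable_EFinP mh hc; rewrite -(expectation_cst Q c) unlock.
have mc : measurable_fun [set: Omega] (EFin \o cst c).
  exact/measurable_EFinP/measurable_cst.
(* Almost everywhere the positive part of [h] is at most that of [c], and the negative part at least
   that of [c]. *)
rewrite integralE [leRHS]integralE; apply: leeB; apply: ae_ge0_le_integral => //.
- exact: measurable_funepos.
- exact: measurable_funepos.
- apply: filterS hc => w hwc _.
  by rewrite !funeposE /= ge_max !le_max !lee_fin hwc lexx orbT.
- exact: measurable_funeneg.
- exact: measurable_funeneg.
- apply: filterS hc => w hwc _.
  by rewrite !funenegE /= ge_max !le_max !lee_fin lerN2 hwc lexx orbT.
Qed.

End almost_sure_bound.

Theorem theorem12 (R : realType) (n M : nat)
  (X : set 'rV[R]_n) (b : 'rV[R]_M)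
  (A : 'I_M -> set 'rV[R]_n)
  (A0 : forall m, A m !=set0)
  (f : forall m, A m -> X -> R)
  (T : 'I_M -> nat)
  (g : forall m, 'I_(T m) -> A m -> R)
  (gamma : forall m, 'I_(T m) -> R)
  (g_meas : forall m t,
    measurable_fun [set: borel_sub (A0 m)] (g m t : borel_sub (A0 m) -> R))
  (P := fun m =>
    @ambiguity_set _ (borel_sub (A0 m)) R (T m) (g m) (gamma m))
  (P_nonempty : forall m, P m !=set0)
  (A_closed : forall m, closed (A m))
  (f_usc : forall m (x : X),
    upper_semicontinuous (fun a : A m => (f m a x)%:E))
  (g_lsc : forall m t, lower_semicontinuous (fun a : A m => (g m t a)%:E))
  (f_growth : forall m (x : X),
    exists (beta0 : R) (beta : 'I_(T m) -> R),
      (forall t, 0 <= beta t) /\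
      (forall a : A m,
        `|f m a x| <= beta0 + \sum_(t < T m) beta t * `|g m t a|)) :
  X_RO b f `<=` X_AS_DRO b f P /\ X_AS_DRO b f P `<=` X_DRO b f P.
Proof.
have mf m (x : X) :
    measurable_fun [set: borel_sub (A0 m)] (fun a : borel_sub (A0 m) => f m a x).
  exact: (@upper_semicontinuous_measurable (nonempty_sub (A0 m)) R _ (f_usc m x)).
have mS m (x : X) :
    measurable ([set a | f m a x <= b ord0 m] : set (borel_sub (A0 m))).
  rewrite -[X in measurable X]setTI.
  under eq_set do rewrite -lee_fin.
  by apply: emeasurable_fun_infty_c => //; exact/measurable_EFinP.
split=> x /= xP m.
- suff -> : [set Q [set a | f m a x <= b ord0 m] | Q in P m] = [set 1%E].
    exact: ereal_inf1.
  have ST : [set a | f m a x <= b ord0 m] = [set: borel_sub (A0 m)].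
    by apply/seteqP; split=> // a _; exact: xP.
  rewrite ST; apply/seteqP; split=> [_ [Q _ <-]|_ ->] /=.
    exact: probability_setT.
  (* Over an empty [P m] the infimum would be [+oo] instead of 1. *)
  by have [Q PQ] := P_nonempty m; exists Q => //; exact: probability_setT.
- apply: ub_ereal_sup => _ [Q PQ <-]; apply: expectation_ae_le => //.
  apply: (probability1_ae (mS m x)); apply/eqP.
  (* The infimum 1 bounds the probability of the event under [Q] from below. *)
  rewrite eq_le (probability_le1 _ (mS m x)) /=.
  by rewrite -(xP m); apply: ereal_inf_lbound; exists Q.
Qed.
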